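(* Let $(b_t, t \in [0,1])$ be standard planar Brownian motion, and let $d_1 := \sup_{x,y \in b[0,1]} \|x-y\|$ be the diameter of its trace $b[0,1] = \{b_t : t \in [0,1]\}$. For $a, h > 0$ define \[ g(a,h) := h \left( \frac{4}{\pi} \exp\left\{ -\frac{\pi^2}{2a^2} \right\} - \frac{4}{3\pi} \exp\left\{ -\frac{9\pi^2}{2a^2} \right\} \right) \left( 1 - \frac{4}{\pi} \exp\left\{ -\frac{\pi^2}{8(a+h)^2} \right\} \right). \] Then $\mathbb{E}\, d_1 \geq \sqrt{8/\pi} + g(1.492, 0.337) \approx 1.6014$.
   Context: Standard planar Brownian motion is the $\mathbb{R}^2$-valued process, started at the origin, whose two coordinates are independent standard one-dimensional Brownian motions. $\|\cdot\|$ is the Euclidean norm on $\mathbb{R}^2$. The symbol $\approx$ indicates the rounded numerical value of the expression $\sqrt{8/\pi} + g(1.492,0.337)$. *)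

(* Defs.v *)
(* MathComp-Analysis *)
From HB Require Import structures.
From mathcomp Require Export all_boot all_order all_algebra.
From mathcomp Require Export all_classical all_reals all_analysis.
Export Order.TTheory GRing.Theory Num.Theory.
Export numFieldNormedType.Exports.

Set Implicit Arguments.
Unset Strict Implicit.
Unset Printing Implicit Defensive.

Local Open Scope classical_set_scope.
Local Open Scope ring_scope.

Section brownian_motion.
Context {d : measure_display} {T : measurableType d} {R : realType}.
Variable P : probability T R.

(* The [A i] may be [setT], so the product rule for the whole family contains
   the one for each subfamily. *)
Definition mutually_independent (n : nat) (X : 'I_n -> T -> R) : Prop :=
  forall A : 'I_n -> set R, (forall i, measurable (A i)) ->
    P (\bigcap_i (X i @^-1` A i)) = (\prod_(i < n) P (X i @^-1` A i))%E.

(* Processes are functions of a real time of which only the restriction to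
   [0, 1] matters. The second argument of [normal_prob] is the standard
   deviation, and [normal_prob 0 0] is not the Dirac mass at 0, whence s < t.
   The starting point and path continuity are only required almost surely. *)
Definition standard_brownian_motion (X : R -> T -> R) : Prop :=
  [/\ forall t : R, t \in `[0, 1] -> measurable_fun setT (X t),
      {ae P, forall w, X 0 w = 0},
      forall (n : nat) (t : 'I_n.+1 -> R),
        (forall i, t i \in `[0, 1]) ->
        (forall i j : 'I_n.+1, (i <= j)%N -> t i <= t j) ->
        mutually_independent
          (fun (i : 'I_n) w => X (t (lift ord0 i)) w - X (t (widen_ord (leqnSn n) i)) w),
      forall s t : R, 0 <= s -> s < t -> t <= 1 ->
        forall A : set R, measurable A ->
          P [set w | A (X t w - X s w)] = normal_prob 0 (Num.sqrt (t - s)) A &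
      {ae P, forall w, {within `[0, 1], continuous (fun t => X t w)}} ].

Definition process_sigma_algebra (X : R -> T -> R) : set (set T) :=
  <<s [set E | exists (t : R) (A : set R),
         [/\ t \in `[0, 1], measurable A & E = X t @^-1` A] ] >>.

Definition independent_processes (X Y : R -> T -> R) : Prop :=
  forall E F : set T, process_sigma_algebra X E -> process_sigma_algebra Y F ->
    P (E `&` F) = (P E * P F)%E.

Definition standard_planar_brownian_motion (b : R -> T -> R * R) : Prop :=
  [/\ standard_brownian_motion (fun t w => (b t w).1),
      standard_brownian_motion (fun t w => (b t w).2) &
      independent_processes (fun t w => (b t w).1) (fun t w => (b t w).2)].

End brownian_motion.

(* The library norm on [R * R] is the sup norm. *)
Definition euclidean_norm {R : realType} (x : R * R) : R :=
  Num.sqrt (x.1 ^+ 2 + x.2 ^+ 2).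

(* [sup] is 0 on unbounded sets; the trace of a continuous path is bounded. *)
Definition diameter {R : realType} (A : set (R * R)) : R :=
  sup [set euclidean_norm (x - y) | x in A & y in A].

Definition trace01 {R : realType} {T : Type} (b : R -> T -> R * R) (w : T) :
    set (R * R) :=
  [set b t w | t in `[0, 1]].

Definition g {R : realType} (a h : R) : R :=
  h * (4 / pi * expR (- (pi ^+ 2 / (2 * a ^+ 2)))
       - 4 / (3 * pi) * expR (- (9 * pi ^+ 2 / (2 * a ^+ 2))))
    * (1 - 4 / pi * expR (- (pi ^+ 2 / (8 * (a + h) ^+ 2)))).

(* Main.v *)
Require Import Defs.
From HB Require Import structures.
From mathcomp Require Import perm.
From mathcomp Require Import measurable_realfun ring lra.
Local Open Scope classical_set_scope.
Local Open Scope ring_scope.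

Set Implicit Arguments.
Unset Strict Implicit.
Unset Printing Implicit Defensive.

(** The diameter dominates the range [R1] over [0, 1] of the first coordinate and
    [|Y|], where [Y] is the total increment of the second coordinate, so by
    independence

      E d_1 >= E [R1; Y < 2] + E [Y; Y >= 2] = E R1 (1 - P (Y >= 2)) + tau,

    where tau = E [Y; Y >= 2] is the standard normal density at 2, and
    P (Y >= 2) <= tau / 2. As E R1 = sqrt (8 / pi), the gain over
    sqrt (8 / pi) is at least tau (1 - sqrt (2 / pi)) > 0.01, whereas
    g (1.492, 0.337) < 0.0056.

    Only E R1 >= sqrt (8 / pi) - small is needed, and R1 may be replaced by the
    range of the walk sampled at n equidistant times. Spitzer's identity
    E max (0, S_1, ..., S_n) = sum_k E max (0, S_k) / k, for both the walk and
    its opposite, gives the sampled range the expectation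
    sum_k E |S_k| / k = sqrt (2 / (pi n)) sum_k 1 / sqrt k. *)

(** * Taylor bounds and numerical estimates *)

(** Drives the Taylor bounds below: the derivative of a signed remainder is the signed remainder
    preceding it. *)
Lemma is_derive_ge0 (R : realType) (f f' : R -> R) :
  (forall x : R, is_derive x 1 f (f' x)) -> 0 <= f 0 ->
  (forall x, 0 <= x -> 0 <= f' x) -> forall x, 0 <= x -> 0 <= f x.
Proof.
move=> df f0 f'0 x x0; apply: le_trans f0 _.
apply: (@ger0_derive1_ndecry R f 0) => //.
- move=> y; rewrite in_itv/= andbT => y0; rewrite derive1E; case: (df y) => _ ->.
  exact/f'0/ltW.
- apply: continuous_subspaceT => y.
  by apply: differentiable_continuous; apply/derivable1_diffP; case: (df y).
Qed.

(* [1 / n!], kept away from the unary [n`!] so that it can be evaluated. *)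
Fixpoint inv_fact (R : realType) n : R :=
  if n is m.+1 then inv_fact R m / n%:R else 1.

Definition expN_taylor (R : realType) n (x : R) : R :=
  \sum_(i < n) (- x) ^+ i * inv_fact R i.

Definition cos_taylor (R : realType) n (x : R) : R :=
  \sum_(i < n) (- 1) ^+ i * x ^+ (2 * i) * inv_fact R (2 * i).

Definition sin_taylor (R : realType) n (x : R) : R :=
  \sum_(i < n) (- 1) ^+ i * x ^+ (2 * i).+1 * inv_fact R (2 * i).+1.

Lemma is_derive_monomial (R : realType) n (c x : R) :
  is_derive x 1 (fun y : R => c * y ^+ n.+1 * inv_fact R n.+1) (c * x ^+ n * inv_fact R n).
Proof.
have n0 : (n.+1%:R : R) != 0 by rewrite pnatr_eq0.
have -> : (fun y : R => c * y ^+ n.+1 * inv_fact R n.+1) =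
          (c * inv_fact R n.+1) \*: (@id R ^+ n.+1).
  by apply/funext => y; rewrite /= fctE /GRing.scale /= mulrAC.
apply: is_derive_eq.
by rewrite /GRing.scale /=; field; rewrite nat1r.
Qed.

Lemma is_derive_expN_taylor (R : realType) n (x : R) :
  is_derive x 1 (@expN_taylor R n.+1) (- expN_taylor n x).
Proof.
elim: n => [|n IH].
  rewrite /expN_taylor big_ord0 oppr0.
  have -> : (fun x : R => \sum_(i < 1) (- x) ^+ i * inv_fact R i) = cst 1.
    by apply/funext => y; rewrite big_ord1 expr0 /= mulr1.
  exact: is_derive_cst.
have -> : @expN_taylor R n.+2 =
   @expN_taylor R n.+1 \+ (fun y => (- 1) ^+ n.+1 * y ^+ n.+1 * inv_fact R n.+1).
  by apply/funext => y; rewrite /expN_taylor big_ord_recr /= (exprNn y).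
apply: is_derive_eq.
  by apply: is_deriveD; exact: is_derive_monomial.
by rewrite /expN_taylor [X in _ = - X]big_ord_recr/= opprD (exprNn x) exprS mulN1r !mulNr.
Qed.

(** The remainders alternate in sign: the signed remainder with [n.+1] terms vanishes at 0 and its
    derivative is the signed remainder with [n] terms. *)
Lemma expN_taylorP (R : realType) n (x : R) : 0 <= x ->
  0 <= (-1) ^+ n * (expR (- x) - expN_taylor n x).
Proof.
elim: n x => [|n IH] x x0.
  by rewrite expr0 mul1r /expN_taylor big_ord0 subr0 expR_ge0.
pose f (y : R) := (-1) ^+ n.+1 * (expR (- y) - expN_taylor n.+1 y).
apply: (@is_derive_ge0 R f (fun y => (-1) ^+ n * (expR (- y) - expN_taylor n y))).
- move=> y; have ? := is_derive_expN_taylor n y.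
  have -> : f = (-1) ^+ n.+1 \*: ((expR \o -%R) - @expN_taylor R n.+1) by [].
  apply: is_derive_eq.
  by rewrite /GRing.scale /= exprS; ring.
- rewrite /f oppr0 expR0 /expN_taylor big_ord_recl/= expr0 /= mulr1.
  rewrite big1 ?addr0 ?subrr ?mulr0// => i _.
  by rewrite oppr0 exprS mul0r mul0r.
- exact: IH.
- exact: x0.
Qed.

Lemma is_derive_sin_taylor (R : realType) n (x : R) :
  is_derive x 1 (@sin_taylor R n) (cos_taylor n x).
Proof.
elim: n => [|n IH].
  rewrite /cos_taylor big_ord0.
  have -> : @sin_taylor R 0 = cst 0 by apply/funext => y; rewrite /sin_taylor big_ord0.
  exact: is_derive_cst.
have -> : @sin_taylor R n.+1 =
   @sin_taylor R n \+ (fun y => (- 1) ^+ n * y ^+ (2 * n).+1 * inv_fact R (2 * n).+1).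
  by apply/funext => y; rewrite /sin_taylor big_ord_recr.
rewrite /cos_taylor big_ord_recr/=.
by apply: is_deriveD; exact: is_derive_monomial.
Qed.

Lemma is_derive_cos_taylor (R : realType) n (x : R) :
  is_derive x 1 (@cos_taylor R n.+1) (- sin_taylor n x).
Proof.
elim: n => [|n IH].
  rewrite /sin_taylor big_ord0 oppr0.
  have -> : @cos_taylor R 1 = cst 1.
    by apply/funext => y; rewrite /cos_taylor big_ord1 muln0 !expr0 /= !mulr1.
  exact: is_derive_cst.
have -> : @cos_taylor R n.+2 =
   @cos_taylor R n.+1 \+ (fun y => (- 1) ^+ n.+1 * y ^+ (2 * n).+2 * inv_fact R (2 * n).+2).
  by apply/funext => y; rewrite /cos_taylor [LHS]big_ord_recr [nat_of_ord _]/= mulnS.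
apply: is_derive_eq.
  by apply: is_deriveD; exact: is_derive_monomial.
by rewrite /sin_taylor [X in _ = - X]big_ord_recr/= opprD exprS mulN1r !mulNr.
Qed.

(** Induction alternating between the two functions, started from [cos <= 1]: a sine remainder is
    differentiated into the cosine remainder with as many terms, and that one into the sine
    remainder with one term fewer. *)
Lemma cos_sin_taylorP (R : realType) n (x : R) : 0 <= x ->
  0 <= (-1) ^+ n.+1 * (cos x - cos_taylor n.+1 x) /\
  0 <= (-1) ^+ n.+1 * (sin x - sin_taylor n.+1 x).
Proof.
elim: n x => [|n IH] x x0.
  have c1 (y : R) : 0 <= (-1) ^+ 1 * (cos y - cos_taylor 1 y).
    rewrite /cos_taylor big_ord1 muln0 !expr0 /= !mulr1 mulN1r opprB subr_ge0.
    exact: cos_le1.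
  split => //.
  apply: (@is_derive_ge0 R (fun y => (-1) ^+ 1 * (sin y - sin_taylor 1 y))
    (fun y => (-1) ^+ 1 * (cos y - cos_taylor 1 y))).
  - move=> y; have ? := is_derive_sin_taylor 1 y.
    by apply: is_derive_eq; rewrite /GRing.scale/=; ring.
  - by rewrite sin0 /sin_taylor big_ord1 [0 ^+ _]exprS mul0r mulr0 mul0r subr0 mulr0.
  - by move=> y _; exact: c1.
  - exact: x0.
have cn (y : R) : 0 <= y -> 0 <= (-1) ^+ n.+2 * (cos y - cos_taylor n.+2 y).
  move: y; apply: (@is_derive_ge0 R (fun y => (-1) ^+ n.+2 * (cos y - cos_taylor n.+2 y))
    (fun y => (-1) ^+ n.+1 * (sin y - sin_taylor n.+1 y))).
  - move=> z; have ? := is_derive_cos_taylor n.+1 z.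
    apply: is_derive_eq; rewrite /GRing.scale/= [in LHS]exprS; ring.
  - rewrite cos0 /cos_taylor big_ord_recl/= !muln0 !expr0 /= !mulr1.
    rewrite big1 ?addr0 ?subrr ?mulr0// => i _.
    by rewrite mulnS [0 ^+ _]exprS mul0r mulr0 mul0r.
  - by move=> z z0; case: (IH z z0).
split; first exact: cn.
apply: (@is_derive_ge0 R (fun y => (-1) ^+ n.+2 * (sin y - sin_taylor n.+2 y))
    (fun y => (-1) ^+ n.+2 * (cos y - cos_taylor n.+2 y))).
- move=> y; have ? := is_derive_sin_taylor n.+2 y.
  by apply: is_derive_eq; rewrite /GRing.scale/=; ring.
- rewrite sin0 /sin_taylor big1 ?subrr ?mulr0// => i _.
  by rewrite [0 ^+ _]exprS mul0r mulr0 mul0r.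
- exact: cn.
- exact: x0.
Qed.

(** Cosine decreases on [0, 2] and vanishes at pi / 2, so its sign at the two endpoints decides; six
    Taylor terms bound it from below, seven from above. *)
Lemma pihalf_bounds (R : realType) :
  157 / 10 ^+ 2 + 795 / 10 ^+ 6 < (pi / 2 : R) < 157 / 10 ^+ 2 + 797 / 10 ^+ 6.
Proof.
have [p2 p2'] := andP (@pihalf_02 R).
have pi2 := @pi_ge2 R.
have cos_lt (x y : R) : 0 <= x <= 2 -> 0 <= y <= 2 -> cos y < cos x -> x < y.
  move=> /andP[x0 x2] /andP[y0 y2]; rewrite ltr_cos//.
  - by rewrite in_itv/= x0 (le_trans x2).
  - by rewrite in_itv/= y0 (le_trans y2).
have pih02 : 0 <= (pi / 2 : R) <= 2 by rewrite !ltW.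
apply/andP; split; apply: cos_lt => //; rewrite ?cos_pihalf.
- by apply/andP; split; lra.
- have x0 : (0 : R) <= 157 / 10 ^+ 2 + 795 / 10 ^+ 6 by lra.
  have [+ _] := cos_sin_taylorP 5 x0.
  rewrite /cos_taylor !big_ord_recr big_ord0.
  rewrite !mulnS !muln0 !addSn !add0n /=; lra.
- by apply/andP; split; lra.
- have x0 : (0 : R) <= 157 / 10 ^+ 2 + 797 / 10 ^+ 6 by lra.
  have [+ _] := cos_sin_taylorP 6 x0.
  rewrite /cos_taylor !big_ord_recr big_ord0.
  rewrite !mulnS !muln0 !addSn !add0n /=; lra.
Qed.

(** * Numerical enclosures of the claimed bound *)

Lemma sqrt_8div_bounds (R : realType) (p : R) :
   157 / 10 ^+ 2 + 795 / 10 ^+ 6 < p / 2 < 157 / 10 ^+ 2 + 797 / 10 ^+ 6 ->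
  1595 / 10 ^+ 3 + 768 / 10 ^+ 6 < Num.sqrt (8 / p) < 1595 / 10 ^+ 3 + 77 / 10 ^+ 5.
Proof.
move=> /andP[pl ph].
have p0 : 0 < p by lra.
(* The root [s] enters only through [s ^+ 2 * p = 8]; an [s] outside the interval would put this
   product off 8. *)
have q0 : (8 / p) * p = 8 by rewrite divfK// gt_eqF.
have s2 : Num.sqrt (8 / p) ^+ 2 = 8 / p.
  by rewrite sqr_sqrtr// divr_ge0// ltW.
have s0 := sqrtr_ge0 (8 / p).
rewrite -s2 in q0; move: s0 q0; move: (Num.sqrt _) => s s0 q0.
apply/andP; split; rewrite ltNge; apply/negP => sle.
  have h1 : s ^+ 2 <= (1595 / 10 ^+ 3 + 768 / 10 ^+ 6) ^+ 2.
    rewrite ler_sqr ?nnegrE.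
      exact: sle.
     exact: s0.
    lra.
  have h2 : s ^+ 2 * p <= (1595 / 10 ^+ 3 + 768 / 10 ^+ 6) ^+ 2 * (3141 / 10 ^+ 3 + 594 / 10 ^+ 6).
    apply: ler_pM; [exact: sqr_ge0|exact: ltW|exact: h1|lra].
  move: h2; rewrite q0. lra.
have h1 : (1595 / 10 ^+ 3 + 77 / 10 ^+ 5) ^+ 2 <= s ^+ 2.
  rewrite ler_sqr ?nnegrE.
  exact: sle. lra. exact: s0.
have h2 : (1595 / 10 ^+ 3 + 77 / 10 ^+ 5) ^+ 2 * (3141 / 10 ^+ 3 + 590 / 10 ^+ 6) <= s ^+ 2 * p.
  apply: ler_pM; [exact: sqr_ge0|lra|exact: h1|lra].
move: h2; rewrite q0; lra.
Qed.

(** The values 0.5542 and 0.55421 enclose a quarter of pi^2 / (2 a^2) for a = 1.492: short Taylor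
    sums suffice at this size, and the fourth power is taken later. Likewise 0.36879 and 0.3688
    enclose pi^2 / (8 (a + h)^2) for a + h = 1.829. *)
Lemma expR_taylor4 (R : realType) :
  [/\ 574 / 10 ^+ 3 + 525 / 10 ^+ 6 <= expR (- (5542 / 10 ^+ 4 + 1 / 10 ^+ 5)) :> R,
      expR (- (5542 / 10 ^+ 4)) <= 574 / 10 ^+ 3 + 532 / 10 ^+ 6 :> R,
      691 / 10 ^+ 3 + 563 / 10 ^+ 6 <= expR (- (3688 / 10 ^+ 4)) :> R &
      expR (- (3687 / 10 ^+ 4 + 9 / 10 ^+ 5)) <= 691 / 10 ^+ 3 + 571 / 10 ^+ 6 :> R].
Proof.
split.
- have x0 : 0 <= 5542 / 10 ^+ 4 + 1 / 10 ^+ 5 :> R by lra.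
  have := expN_taylorP 8 x0; move: (expR _) => e.
  rewrite /expN_taylor !big_ord_recr big_ord0 /=; lra.
- have x0 : 0 <= 5542 / 10 ^+ 4 :> R by lra.
  have := expN_taylorP 9 x0; move: (expR _) => e.
  rewrite /expN_taylor !big_ord_recr big_ord0 /=; lra.
- have x0 : 0 <= 3688 / 10 ^+ 4 :> R by lra.
  have := expN_taylorP 8 x0; move: (expR _) => e.
  rewrite /expN_taylor !big_ord_recr big_ord0 /=; lra.
- have x0 : 0 <= 3687 / 10 ^+ 4 + 9 / 10 ^+ 5 :> R by lra.
  have := expN_taylorP 7 x0; move: (expR _) => e.
  rewrite /expN_taylor !big_ord_recr big_ord0 /=; lra.
Qed.

(** Serves the second exponential of [g], whose exponent is about -19.95; [e >= 2] is enough because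
    2^-19 < 2 / 10^6. *)
Lemma expRN19_le (R : realType) : expR (- 19) <= 2 / 10 ^+ 6 :> R.
Proof.
rewrite expRN -[X in expR X]mulr1 expRM_natl.
have e12 : 2 <= expR 1 :> R by apply: le_trans (expR_ge1Dx 1); lra.
apply: (@le_trans _ _ (2 ^+ 19)^-1); last by lra.
by rewrite lef_pV2 ?posrE ?exprn_gt0 ?expR_gt0// lerXn2r ?nnegrE ?expR_ge0.
Qed.

Lemma ler_pXn4 (R : realType) (x y : R) : 0 <= x -> x <= y -> x ^+ 4 <= y ^+ 4.
Proof. by move=> x0 xy; rewrite lerXn2r// nnegrE (le_trans x0). Qed.

Lemma g_exponentials (R : realType) (p : R) (a := 1492 / 1000 : R) (h := 337 / 1000 : R) :
   157 / 10 ^+ 2 + 795 / 10 ^+ 6 < p / 2 < 157 / 10 ^+ 2 + 797 / 10 ^+ 6 ->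
  [/\ (574 / 10 ^+ 3 + 525 / 10 ^+ 6) ^+ 4 <= expR (- (p ^+ 2 / (2 * a ^+ 2))) <=
        (574 / 10 ^+ 3 + 532 / 10 ^+ 6) ^+ 4,
      expR (- (9 * p ^+ 2 / (2 * a ^+ 2))) <= 2 / 10 ^+ 6 &
      691 / 10 ^+ 3 + 563 / 10 ^+ 6 <= expR (- (p ^+ 2 / (8 * (a + h) ^+ 2))) <=
        691 / 10 ^+ 3 + 571 / 10 ^+ 6].
Proof.
move=> /andP[pl ph].
have p2l : (3141 / 10 ^+ 3 + 590 / 10 ^+ 6) ^+ 2 <= p ^+ 2.
  by rewrite ler_sqr ?nnegrE; lra.
have p2h : p ^+ 2 <= (3141 / 10 ^+ 3 + 594 / 10 ^+ 6) ^+ 2.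
  by rewrite ler_sqr ?nnegrE; lra.
have [e1l e1h e3l e3h] := expR_taylor4 R.
have -> : a + h = 1829 / 1000 by rewrite /a /h; clear; lra.
move: (p ^+ 2) p2l p2h => q ql qh {pl ph p}.
split.
- apply/andP; split.
    apply: le_trans (_ : expR (- (5542 / 10 ^+ 4 + 1 / 10 ^+ 5)) ^+ 4 <= _).
      by apply: ler_pXn4 e1l; clear; lra.
    by rewrite -expRM_natl ler_expR /a; clear - ql qh; lra.
  apply: le_trans (_ : expR (- (5542 / 10 ^+ 4)) ^+ 4 <= _).
    by rewrite -expRM_natl ler_expR /a; clear - ql qh; lra.
  by apply: ler_pXn4 e1h; exact: expR_ge0.
- apply: le_trans (expRN19_le R); rewrite ler_expR /a; clear - ql qh; lra.
- apply/andP; split.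
    apply: le_trans e3l _; rewrite ler_expR; clear - ql qh; lra.
  apply: le_trans e3h; rewrite ler_expR; clear - ql qh; lra.
Qed.

(** With the exponentials as variables and [c = 4 / p], the claim becomes polynomial; the two
    factors are enclosed separately before they are multiplied. *)
Lemma g_bounds_aux (R : realType) (p x1 x2 x3 : R) (h := 337 / 1000 : R) :
   157 / 10 ^+ 2 + 795 / 10 ^+ 6 < p / 2 < 157 / 10 ^+ 2 + 797 / 10 ^+ 6 ->
  (574 / 10 ^+ 3 + 525 / 10 ^+ 6) ^+ 4 <= x1 <= (574 / 10 ^+ 3 + 532 / 10 ^+ 6) ^+ 4 ->
  0 <= x2 <= 2 / 10 ^+ 6 ->
  691 / 10 ^+ 3 + 563 / 10 ^+ 6 <= x3 <= 691 / 10 ^+ 3 + 571 / 10 ^+ 6 ->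
  5584 / 10 ^+ 6 <= h * (4 / p * x1 - 4 / (3 * p) * x2) * (1 - 4 / p * x3) <= 5587 / 10 ^+ 6.
Proof.
move=> /andP[pl ph] /andP[x1l x1h] /andP[x20 x2h] /andP[x3l x3h].
have p0 : 0 < p by lra.
have -> : 4 / (3 * p) = 4 / p / 3 by field; lra.
have cl : 1273 / 10 ^+ 3 + 238 / 10 ^+ 6 <= 4 / p by rewrite ler_pdivlMr//; lra.
have ch : 4 / p <= 1273 / 10 ^+ 3 + 241 / 10 ^+ 6 by rewrite ler_pdivrMr//; lra.
move: (4 / p) cl ch => c cl ch {pl ph p0 p}.
have x1l' : 1089 / 10 ^+ 4 + 52 / 10 ^+ 6 <= x1 by move: x1l; lra.
have x1h' : x1 <= 1089 / 10 ^+ 4 + 58 / 10 ^+ 6 by move: x1h; lra.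
clear x1l x1h.
have [Al Ah] : 1387 / 10 ^+ 4 + 20 / 10 ^+ 6 <= c * x1 - c / 3 * x2 /\
               c * x1 - c / 3 * x2 <= 1387 / 10 ^+ 4 + 30 / 10 ^+ 6.
  clear x3l x3h. (split; nra).
have [Bl Bh] : 1194 / 10 ^+ 4 + 60 / 10 ^+ 6 <= 1 - c * x3 /\
               1 - c * x3 <= 1194 / 10 ^+ 4 + 80 / 10 ^+ 6.
  clear - x3l x3h cl ch. (split; nra).
move: (_ - _) (1 - _) Al Ah Bl Bh => A B Al Ah Bl Bh.
clear - Al Ah Bl Bh; rewrite /h.
(apply/andP; split; nra).
Qed.

Lemma sqrt_8pi_bounds (R : realType) :
  1595 / 10 ^+ 3 + 768 / 10 ^+ 6 < Num.sqrt (8 / pi : R) < 1595 / 10 ^+ 3 + 77 / 10 ^+ 5.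
Proof. exact/sqrt_8div_bounds/pihalf_bounds. Qed.

Lemma g_bounds (R : realType) :
  5584 / 10 ^+ 6 <= (g (1492 / 1000) (337 / 1000) : R) <= 5587 / 10 ^+ 6.
Proof.
have [e1 e2 e3] := g_exponentials (pihalf_bounds R).
apply: g_bounds_aux (pihalf_bounds R) e1 _ e3.
by rewrite expR_ge0.
Qed.

(** An error below half a unit of the fourth decimal is what rounding to 1.6014 means. The value
    exceeds the lower end 1.60135 by only a few millionths, whence the six decimals kept above. *)
Lemma sqrt_8pi_g_approx (R : realType) :
  `| Num.sqrt (8 / pi) + g (1492 / 1000) (337 / 1000) - (1 + 6 / 10 + 14 / 10 ^+ 4) : R |
     < 5 / 10 ^+ 5.
Proof.
move: (sqrt_8pi_bounds R) (g_bounds R) => /andP[sl sh] /andP[gl gh].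
move: (Num.sqrt _) (g _ _) sl sh gl gh => s e sl sh gl gh.
by rewrite ltr_norml; apply/andP; split; lra.
Qed.

(** Here [s] is sqrt (8 / pi), [e] the value of [g], [t] the Gaussian tail and [i] stands for 1 /
    sqrt n. As [s < 1.6], the tail gains t (1 - s / 2) >= 0.2 t >= 0.008, while sampling costs at
    most s i <= 0.0016; the remaining 0.0064 exceeds [e]. *)
Lemma range_tail_arith (R : realType) (s e t i : R) :
  1595 / 10 ^+ 3 + 768 / 10 ^+ 6 < s < 1595 / 10 ^+ 3 + 77 / 10 ^+ 5 ->
  5584 / 10 ^+ 6 <= e <= 5587 / 10 ^+ 6 -> 4 / 100 <= t <= 1 -> 0 <= i <= 1000^-1 ->
  0 <= s * (1 - i) /\ s + e <= s * (1 - i) * (1 - t / 2) + t.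
Proof.
move=> /andP[sl sh] /andP[_ eh] /andP[tl th] /andP[i0 ih].
have s_lt : s < 16 / 10 by lra.
have s_gt : 1 < s by lra.
have e_lt : e <= 56 / 10 ^+ 4 by lra.
clear sl sh eh.
have rho_ge : s - 16 / 10 ^+ 4 <= s * (1 - i).
  have : s * i <= 16 / 10 * 1000^-1 by apply: ler_pM; lra.
  lra.
split; first by lra.
have : (s - 16 / 10 ^+ 4) * (1 - t / 2) <= s * (1 - i) * (1 - t / 2).
  by apply: ler_wpM2r => //; lra.
have : s * t <= 16 / 10 * t by apply: ler_wpM2r; lra.
lra.
Qed.

(** * Gaussian integrals *)

Section normal_integrals.
Context {R : realType}.
Local Notation mu := (@lebesgue_measure R).
Local Open Scope ereal_scope.

(** The Radon-Nikodym derivative and [normal_pdf] have the same integral over every measurable set,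
    so they agree almost everywhere and may be exchanged in the change of variables. *)
Lemma ge0_integral_normal_prob (m s : R) (E : set R) (f : R -> \bar R) :
  measurable E -> measurable_fun E f -> (forall x, 0 <= f x) ->
  \int[normal_prob m s]_(x in E) f x = \int[mu]_(x in E) (f x * (normal_pdf m s x)%:E).
Proof.
move=> mE mf f0.
rewrite -(Radon_Nikodym_SigmaFinite.change_of_variables (normal_prob_dominates m s))//=.
apply: ae_eq_integral => //=.
- apply: emeasurable_funM => //; apply: measurable_funTS.
  apply: measurable_int; apply: Radon_Nikodym_SigmaFinite.f_integrable.
  exact: normal_prob_dominates.
- apply: emeasurable_funM => //; apply: measurable_funTS.
  by apply/measurable_EFinP; exact: measurable_normal_pdf.
- apply: ae_eqe_mul2l.
  apply: integral_ae_eq => //=.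
  + apply: integrableS (Radon_Nikodym_SigmaFinite.f_integrable _) => //.
    exact: normal_prob_dominates.
  + apply: measurable_funTS.
    by apply/measurable_EFinP; exact: measurable_normal_pdf.
  + move=> A _ mA; rewrite -Radon_Nikodym_SigmaFinite.f_integral//.
    exact: normal_prob_dominates.
Qed.


(** Supplies the primitive behind all the first moments below. *)
Lemma is_derive_normal_pdf (s x : R) : s != 0%R ->
  is_derive x 1%R (fun y => - s ^+ 2 * normal_pdf 0 s y)%R (x * normal_pdf 0 s x)%R.
Proof.
move=> s0; rewrite normal_pdfE//.
have -> : (fun y => - s ^+ 2 * (normal_peak s * normal_fun 0 s y))%R =
    ((- s ^+ 2 * normal_peak s) \*: (expR \o ((- (s ^+ 2 *+ 2)^-1) \*: (@id R ^+ 2))))%R.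
  apply/funext => y; rewrite /= /GRing.scale /= mulrA /normal_fun subr0 !fctE /GRing.scale/=.
  by congr (_ * expR _)%R; rewrite mulNr mulNr mulrC.
apply: is_derive_eq.
rewrite /GRing.scale/= !fctE /GRing.scale/= /normal_fun subr0 mulr1.
have -> : (- (x ^+ 2) / (s ^+ 2 *+ 2) = - (s ^+ 2 *+ 2)^-1 * x ^+ 2)%R.
  by rewrite mulNr mulNr mulrC.
rewrite -mulr_natr; field.
by rewrite s0.
Qed.

Lemma continuous_idM_normal_pdf (s : R) : s != 0%R ->
  continuous (fun x : R => x * normal_pdf 0 s x)%R.
Proof.
move=> s0 x; apply: cvgM; first exact: cvg_id.
exact: continuous_normal_pdf.
Qed.

Lemma cvgy_normal_pdf (s : R) : s != 0%R ->
  normal_pdf 0 s x @[x --> +oo%R] --> 0%R.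
Proof.
move=> s0; rewrite normal_pdfE//.
rewrite -[X in _ --> X](mulr0 (normal_peak s)).
apply: cvgMl_tmp.
rewrite /normal_fun.
under eq_fun do rewrite subr0 mulNr.
apply: (cvg_comp (fun x : R => x ^+ 2 / (s ^+ 2 *+ 2))%R (fun x => expR (- x))); last first.
  exact: cvgr_expR.
apply: gt0_cvgMly.
  by rewrite invr_gt0 pmulrn_lgt0// exprn_even_gt0.
exact: cvgr_expr2.
Qed.

Lemma integral_id_normal_pdf (s c : R) : s != 0%R -> (0 <= c)%R ->
  \int[mu]_(x in `[c, +oo[) (x * normal_pdf 0 s x)%:E = (s ^+ 2 * normal_pdf 0 s c)%:E.
Proof.
move=> s0 c0.
have dF (x : R) := is_derive_normal_pdf x s0.
rewrite (@ge0_continuous_FTC2y _ _ (fun y => - s ^+ 2 * normal_pdf 0 s y)%R _ 0%R).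
- by rewrite sub0e -EFinN mulNr opprK.
- by move=> x cx; rewrite mulr_ge0 ?normal_pdf_ge0// (le_trans c0).
- by apply: continuous_subspaceT; exact: continuous_idM_normal_pdf.
- rewrite -[X in _ --> X](mulr0 (- s ^+ 2)%R).
  by apply: cvgMl_tmp; exact: cvgy_normal_pdf.
- by move=> x _; case: (dF x).
- apply: cvg_at_right_filter; apply: cvgMl_tmp; by apply: continuous_normal_pdf.
- by move=> x _; rewrite derive1E; case: (dF x) => _ ->.
Qed.

(** By symmetry, twice the half-line integral with [c = 0]. *)
Lemma integral_normr_normal_prob (s : R) : (0 < s)%R ->
  \int[normal_prob 0 s]_x (`|x|)%:E = (s * Num.sqrt (2 / pi))%:E.
Proof.
move=> s0; have sn0 := lt0r_neq0 s0.
rewrite ge0_integral_normal_prob//; last first.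
  apply/measurable_EFinP; exact: normr_measurable.
under eq_integral do rewrite -EFinM.
rewrite ge0_symfun_integralT.
- have -> : [set x : R | (0 <= x)%R] = `[0%R, +oo[%classic.
    by apply/seteqP; split => x /=; rewrite in_itv/= andbT.
  under eq_integral.
    move=> x; rewrite inE/= in_itv/= andbT => x0; rewrite ger0_norm//; over.
  rewrite integral_id_normal_pdf// normal_pdfE// /normal_fun subr0 expr0n oppr0 mul0r expR0 mulr1.
  rewrite -EFinM; congr EFin.
  have p0 := @pi_gt0 R.
  have -> : normal_peak s = (s * (Num.sqrt 2 * Num.sqrt pi))^-1%R.
    rewrite /normal_peak -mulrnAr sqrtrM ?sqr_ge0// sqrtr_sqr gtr0_norm//.
    by rewrite -mulr_natl sqrtrM.
  rewrite sqrtrM// sqrtrV ?ltW//.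
  have q0 : Num.sqrt pi != 0%R :> R by rewrite gt_eqF// sqrtr_gt0.
  have r0 : Num.sqrt 2 != 0%R :> R by rewrite gt_eqF// sqrtr_gt0.
  (* The factor 2 becomes [Num.sqrt 2 ^+ 2], so that [field] can treat the root as an atom. *)
  rewrite -[X in (X * _ = _)%R](@sqr_sqrtr R 2)//; field.
  by rewrite q0 r0 sn0.
- by move=> x; rewrite mulr_ge0// normal_pdf_ge0.
- move=> x; apply: cvgM; last exact: continuous_normal_pdf.
  exact: norm_continuous.
- move=> x /=; rewrite normrN; congr (_ * _)%R.
  by rewrite normal_pdfE// /normal_fun !subr0 sqrrN.
Qed.

Lemma integral_tail_normal_prob (s c : R) : s != 0%R -> (0 <= c)%R ->
  \int[normal_prob 0 s]_(x in `[c, +oo[) (`|x|)%:E = (s ^+ 2 * normal_pdf 0 s c)%:E.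
Proof.
move=> s0 c0; rewrite -integral_id_normal_pdf//.
rewrite ge0_integral_normal_prob//; last first.
  by apply: measurable_funTS; apply/measurable_EFinP; exact: normr_measurable.
apply: eq_integral => x; rewrite inE/= in_itv/= andbT => cx.
by rewrite -EFinM ger0_norm// (le_trans c0).
Qed.

End normal_integrals.

(** * Spitzer's identity *)

Section max_partial_sum.
Context {R : realType}.
Implicit Types (s : seq R) (x y : R).

(* The largest of the partial sums [0, x1, x1 + x2, ...] of [s]. *)
Definition maxsum s : R := foldr (fun x m => Num.max 0 (x + m)) 0 s.

Lemma maxsum_ge0 s : 0 <= maxsum s.
Proof. by case: s => //= x s; rewrite le_max lexx. Qed.

(** The fold unfolds the first step; this is the recursion on the last one. *)
Lemma maxsum_rcons s y :
  maxsum (rcons s y) = Num.max (maxsum s) (\sum_(x <- rcons s y) x).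
Proof.
elim: s => [|x s IH] /=; first by rewrite big_seq1 addr0.
by rewrite IH big_cons addr_maxr maxA.
Qed.

Lemma maxsum_ge_sum s : \sum_(x <- s) x <= maxsum s.
Proof.
elim: s => [|x s IH] /=; first by rewrite big_nil.
by rewrite big_cons le_max lerD2l IH orbT.
Qed.

Lemma maxsum_cons_rcons x s s' y : x :: s = rcons s' y ->
  maxsum (x :: s) = if 0 < \sum_(z <- x :: s) z then x + maxsum s else maxsum s'.
Proof.
move=> e; case: ltP => [sum_gt0|sum_le0].
  have := lt_le_trans sum_gt0 (maxsum_ge_sum _).
  by rewrite /= lt_max ltxx/= => ?; apply/max_idPr/ltW.
by rewrite e maxsum_rcons -e; apply/max_idPl/(le_trans sum_le0)/maxsum_ge0.
Qed.

(** Turns the maximum into a value of the walk, which later makes the sampled range a difference of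
    two values of the path. *)
Lemma maxsum_take s : exists2 k, (k <= size s)%N & maxsum s = \sum_(x <- take k s) x.
Proof.
elim: s => [|x s [k ks IH]] /=; first by exists 0%N; rewrite ?big_nil.
have [_|_] := leP 0 (x + maxsum s).
  by exists k.+1 => //=; rewrite big_cons IH.
by exists 0%N => //; rewrite take0 big_nil.
Qed.

Lemma maxsum_le_norm s : maxsum s <= \sum_(x <- s) `|x|.
Proof.
elim: s => [|x s IH] /=; first by rewrite big_nil.
by rewrite big_cons ge_max addr_ge0 ?sumr_ge0//= lerD ?ler_norm.
Qed.

End max_partial_sum.

Lemma Rintegral_sum d (T : measurableType d) (R : realType)
    (mu : {measure set T -> \bar R}) (D : set T) n (f : nat -> T -> R) :
  measurable D -> (forall i, mu.-integrable D (EFin \o f i)) ->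
  \int[mu]_(x in D) \sum_(i < n) f i x = \sum_(i < n) \int[mu]_(x in D) f i x.
Proof.
move=> mD fi; elim: n => [|n IH].
  rewrite big_ord0; under eq_Rintegral do rewrite big_ord0.
  by rewrite Rintegral_cst// mul0r.
rewrite big_ord_recr/= -IH -RintegralD//.
  by under eq_Rintegral do rewrite big_ord_recr.
rewrite (_ : _ \o _ = fun x => (\sum_(i < n) (f i x)%:E)%E); last first.
  by apply/funext => x /=; rewrite sumEFin.
by apply: integrable_sum => // i _; exact: fi.
Qed.

Section maxsum_measurable.
Context d (T : measurableType d) (R : realType) (I : Type).
Implicit Types (X : I -> T -> R) (l : seq I).

Lemma measurable_maxsum X l : (forall i, measurable_fun setT (X i)) ->
  measurable_fun setT (fun w => maxsum [seq X i w | i <- l]).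
Proof.
move=> mX; elim: l => [|i l IH] /=; first exact: measurable_cst.
apply: measurable_maxr; first exact: measurable_cst.
exact: measurable_funD.
Qed.

Lemma integrable_maxsum (mu : {measure set T -> \bar R}) X l :
  (forall i, mu.-integrable setT (EFin \o X i)) ->
  mu.-integrable setT (EFin \o (fun w => maxsum [seq X i w | i <- l])).
Proof.
move=> iX.
have mX i : measurable_fun setT (X i).
  by apply/measurable_EFinP; exact: measurable_int (iX i).
apply: (@le_integrable _ _ _ mu _ measurableT _ (fun w => \sum_(i <- l) (`|X i w|)%:E)%E).
- by apply/measurable_EFinP; exact: measurable_maxsum.
- move=> w _; rewrite sumEFin /= lee_fin ger0_norm ?maxsum_ge0// ger0_norm ?sumr_ge0//.
  by have := maxsum_le_norm [seq X i w | i <- l]; rewrite big_map.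
- apply: integrable_sum => // i _.
  by have := integrable_norm (iX i).
Qed.

End maxsum_measurable.

(** * Laws of independent families *)

Section exchangeability.
Context d (T : measurableType d) (R : realType) (P : probability T R).

(** Independence speaks about rectangles, and unlike cylinders over one coordinate they are stable
    under intersection, as uniqueness of measures requires. *)
Lemma measurable_tuple_rectangles n :
  @measurable _ (n.-tuple R) = <<s [set E | exists2 A : 'I_n -> set R,
    (forall i, measurable (A i)) & E = \bigcap_i [set t | A i (tnth t i)] ] >>.
Proof.
apply/seteqP; split.
  apply: smallest_sub; first exact: smallest_sigma_algebra.
  rewrite -bigcup_seq => E [i _ [B mB <-]].
  apply: sub_sigma_algebra.
  (* A cylinder over coordinate [i] is the rectangle with [setT] on all other sides. *)
  exists (fun j => if j == i then B else setT) => [j|].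
    by case: ifP.
  apply/seteqP; split => t /= Bt.
    by move=> j _ /=; case: eqP => // ->; case: Bt.
  by split => //; have := Bt i I; rewrite /= eqxx.
apply: smallest_sub; first exact: sigma_algebra_measurable.
move=> _ [A mA ->].
apply: fin_bigcap_measurable => // i _.
by rewrite -[X in measurable X]setTI; exact: measurable_tnth.
Qed.

Variables (n : nat) (X Y : 'I_n -> T -> R).
Hypotheses (mX : forall i, measurable_fun setT (X i))
           (mY : forall i, measurable_fun setT (Y i)).
Hypotheses (iX : mutually_independent P X) (iY : mutually_independent P Y).
Hypothesis XY : forall i A, measurable A -> P (X i @^-1` A) = P (Y i @^-1` A).

Let tup (Z : 'I_n -> T -> R) w : n.-tuple R := [tuple Z i w | i < n].

Let measurable_tup Z : (forall i, measurable_fun setT (Z i)) -> measurable_fun setT (tup Z).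
Proof.
move=> mZ; apply/measurable_fun_tnthP => i.
rewrite (_ : _ \o _ = Z i)//.
by apply/funext => w /=; rewrite tnth_mktuple.
Qed.

Let tupM Z (mZ : forall i, measurable_fun setT (Z i)) : {mfun T >-> n.-tuple R} :=
  HB.pack (tup Z) (isMeasurableFun.Build _ _ _ _ _ (measurable_tup mZ)).

(** Independence factors both laws on rectangles, with equal factors, and rectangles determine a
    probability. *)
Let law_eq A : measurable A ->
  distribution P (tupM mX) A = distribution P (tupM mY) A.
Proof.
move=> mA.
apply: (@measure_unique _ _ _ _ (fun=> setT) (measurable_tuple_rectangles n)
  _ _ _ (distribution P (tupM mX)) (distribution P (tupM mY))) => //.
- move=> _ _ [B mB ->] [C mC ->]; exists (fun i => B i `&` C i).
    by move=> i; exact: measurableI.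
  apply/seteqP; split => t /=.
    by move=> [Bt Ct] i _; split; [exact: Bt|exact: Ct].
  by move=> BCt; split => i _; have [] := BCt i I.
- move=> _; exists (fun=> setT) => //.
  by apply/seteqP; split => t.
- by apply/seteqP; split => // t _; exists 0%N.
- move=> _ [B mB ->] /=; rewrite /distribution /pushforward.
  have preE (Z : 'I_n -> T -> R) : tup Z @^-1` (\bigcap_i [set t | B i (tnth t i)]) =
      \bigcap_i (Z i @^-1` B i).
    apply/seteqP; split => w /= Bw i _; have := Bw i I; by rewrite /= tnth_mktuple.
  by rewrite !preE iX// iY//; apply: eq_bigr => i _; exact: XY.
- by move=> _; rewrite (le_lt_trans (probability_le1 _ _))// ltry.
Qed.

Let ge0_eq_law (F : n.-tuple R -> \bar R) : measurable_fun setT F ->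
  (forall t, 0 <= F t)%E ->
  (\int[P]_w F (tup X w) = \int[P]_w F (tup Y w))%E.
Proof.
move=> mF F0.
rewrite -(ge0_integral_distribution (tupM mX) mF F0).
rewrite -(ge0_integral_distribution (tupM mY) mF F0).
by apply: eq_measure_integral => A mA _; exact: law_eq.
Qed.

Lemma eq_law_integral (F : n.-tuple R -> \bar R) : measurable_fun setT F ->
  (\int[P]_w F [tuple X i w | i < n] = \int[P]_w F [tuple Y i w | i < n])%E.
Proof.
move=> mF.
have intE (Z : 'I_n -> T -> R) : (\int[P]_w F (tup Z w) =
    \int[P]_w (F^\+ (tup Z w)) - \int[P]_w (F^\- (tup Z w)))%E.
  rewrite integralE; congr (_ - _)%E; apply: eq_integral => w _.
    by rewrite !funeposE.
  by rewrite !funenegE.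
rewrite (intE X) (intE Y); congr (_ - _)%E.
- exact: (ge0_eq_law (measurable_funepos mF) (funepos_ge0 F)).
- exact: (ge0_eq_law (measurable_funeneg mF) (funeneg_ge0 F)).
Qed.

End exchangeability.

(** * One step of Spitzer's identity *)

Section spitzer.
Context d (T : measurableType d) (R : realType) (P : probability T R).
Variables (n : nat) (xi : nat -> T -> R).
Hypothesis ixi : forall i, P.-integrable setT (EFin \o xi i).
Hypothesis indep : mutually_independent P (fun i : 'I_n.+1 => xi i).
Hypothesis law_xi : forall i j A, (i < n.+1)%N -> (j < n.+1)%N -> measurable A ->
  P (xi i @^-1` A) = P (xi j @^-1` A).

Let mxi i : measurable_fun setT (xi i).
Proof. by apply/measurable_EFinP; exact: measurable_int (ixi i). Qed.

(** A permuted family is again independent, since its rectangles are rectangles of the original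
    family with permuted sides; the common law matches the marginals. *)
Let exchangeable (s s' : 'I_n.+1 -> 'I_n.+1) (F : n.+1.-tuple R -> R) :
  cancel s s' -> cancel s' s -> measurable_fun setT F ->
  \int[P]_w F [tuple xi i w | i < n.+1] = \int[P]_w F [tuple xi (s i) w | i < n.+1].
Proof.
move=> sK s'K mF; rewrite /Rintegral; congr fine.
apply: (@eq_law_integral _ T R P n.+1 (fun i => xi i) (fun i => xi (s i)) _ _ _ _ _ (EFin \o F)) => //.
- move=> A mA.
  have -> : \bigcap_i (xi (s i) @^-1` A i) = \bigcap_(j in [set: 'I_n.+1]) (xi j @^-1` A (s' j)).
    apply/seteqP; split => w /= Aw i _.
      by have := Aw (s' i) I; rewrite /= s'K.
    by have := Aw (s i) I; rewrite /= sK.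
  rewrite indep; last by move=> i; exact: mA.
  rewrite (reindex_inj (can_inj sK)) /=.
  by apply: eq_bigr => i _; rewrite sK.
- by move=> i A mA; apply: law_xi.
- exact/measurable_EFinP.
Qed.

Let S w := \sum_(i < n.+1) xi i w.

Let mS : measurable_fun setT S.
Proof. exact: measurable_sum. Qed.

Let integrable_if (f g : T -> R) :
  P.-integrable setT (EFin \o f) -> P.-integrable setT (EFin \o g) ->
  P.-integrable setT (EFin \o (fun w => if 0 < S w then f w else g w)).
Proof.
move=> fi gi.
apply: (@le_integrable _ _ _ P _ measurableT _ (fun w => (`|f w|)%:E + (`|g w|)%:E)%E).
- apply/measurable_EFinP; apply: measurable_fun_ifT.
  + exact: measurable_fun_ltr.
  + by apply/measurable_EFinP; exact: measurable_int fi.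
  + by apply/measurable_EFinP; exact: measurable_int gi.
- move=> w _; rewrite -EFinD /= lee_fin [leRHS]ger0_norm ?addr_ge0//.
  by case: ifP => _; rewrite ?lerDl ?lerDr.
- by apply: integrableD => //; [have := integrable_norm fi|have := integrable_norm gi].
Qed.

Let sum_permuted (s : 'I_n.+1 -> 'I_n.+1) w : injective s ->
  \sum_(i < n.+1) xi (s i) w = S w.
Proof. by move=> s_inj; rewrite /S [RHS](reindex_inj s_inj). Qed.

Let mpos : measurable_fun setT
  (fun t : n.+1.-tuple R => 0 < \sum_(i < n.+1) tnth t i).
Proof.
apply: measurable_fun_ltr => //; apply: measurable_sum => i.
exact: measurable_tnth.
Qed.

(** By exchangeability all [n.+1] increments have the same integral over S > 0, and there they add
    up to [S]. *)
Let first_increment :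
  \int[P]_w (if 0 < S w then xi 0 w else 0) =
  (\int[P]_w Num.max 0 (S w)) / n.+1%:R.
Proof.
have swap (i : 'I_n.+1) : \int[P]_w (if 0 < S w then xi 0 w else 0) =
    \int[P]_w (if 0 < S w then xi i w else 0).
  pose F (t : n.+1.-tuple R) :=
    if 0 < \sum_(i < n.+1) tnth t i then tnth t ord0 else 0.
  have mF : measurable_fun setT F.
    by apply: measurable_fun_ifT; [exact: mpos|exact: measurable_tnth|exact: measurable_cst].
  have := exchangeable (@tpermK _ ord0 i) (@tpermK _ ord0 i) mF.
  congr (_ = _); apply: eq_Rintegral => w _.
    by rewrite /F tnth_mktuple; under eq_bigr do rewrite tnth_mktuple.
  rewrite /F tnth_mktuple; under eq_bigr do rewrite tnth_mktuple.
  by rewrite sum_permuted ?tpermL//; exact: perm_inj.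
have n0 : n.+1%:R != 0 :> R by rewrite pnatr_eq0.
apply: (mulIf n0); rewrite mulfVK// mulr_natr.
transitivity (\sum_(i < n.+1) \int[P]_w (if 0 < S w then xi i w else 0)).
  by rewrite (eq_bigr (fun=> \int[P]_w (if 0 < S w then xi 0 w else 0)))
    ?sumr_const ?card_ord// => i _; rewrite -swap.
rewrite -(@Rintegral_sum _ _ _ P setT n.+1 (fun i w => if 0 < S w then xi i w else 0))//; last first.
  by move=> i; apply: integrable_if => //; exact: integrable0.
apply: eq_Rintegral => w _; case: ltP => S0.
  by [].
by rewrite big1.
Qed.

(* When the total [S w] is positive, the maximum is [xi 0] plus the maximum for
   the walk deprived of its first step; otherwise it is the maximum for the walk
   deprived of its last step. Exchangeability identifies the two shorter walks on
   [S > 0] and replaces [xi 0] there by [S / n.+1]. *)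
Lemma spitzer_step :
  \int[P]_w maxsum [seq xi i w | i <- iota 0 n.+1] =
  (\int[P]_w Num.max 0 (S w)) / n.+1%:R + \int[P]_w maxsum [seq xi i w | i <- iota 0 n].
Proof.
pose tl w := maxsum [seq xi i w | i <- iota 1 n].
pose hd w := maxsum [seq xi i w | i <- iota 0 n].
have itl : P.-integrable setT (EFin \o tl) by exact: integrable_maxsum.
have ihd : P.-integrable setT (EFin \o hd) by exact: integrable_maxsum.
have i0 : P.-integrable setT (EFin \o (fun=> 0 : R)) by exact: integrable0.
(* The cyclic shift [ordS] keeps the total and carries the walk without its last step to the walk
   without its first. *)
have shift : \int[P]_w (if 0 < S w then hd w else 0) =
    \int[P]_w (if 0 < S w then tl w else 0).
  pose F (t : n.+1.-tuple R) := if 0 < \sum_(i < n.+1) tnth t i then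
    maxsum [seq tnth t i | i <- take n (enum 'I_n.+1)] else 0.
  have mF : measurable_fun setT F.
    apply: measurable_fun_ifT; [exact: mpos| |exact: measurable_cst].
    by apply: measurable_maxsum => i; exact: measurable_tnth.
  have := exchangeable (@ordSK n.+1) (@ord_predK n.+1) mF.
  congr (_ = _); apply: eq_Rintegral => w _.
    rewrite /F; under eq_bigr do rewrite tnth_mktuple.
    congr (if _ then maxsum _ else 0).
    rewrite (eq_map (_ : _ =1 (fun k => xi k w) \o val)); last first.
      by move=> i; rewrite tnth_mktuple.
    by rewrite map_comp map_take val_enum_ord take_iota (minn_idPl _).
  rewrite /F; under eq_bigr do rewrite tnth_mktuple.
  rewrite sum_permuted; last exact: ordS_inj.
  congr (if _ then maxsum _ else 0).
  have valE : [seq val i | i <- take n (enum 'I_n.+1)] = iota 0 n.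
    by rewrite map_take val_enum_ord take_iota (minn_idPl _).
  transitivity [seq xi (val i).+1 w | i <- take n (enum 'I_n.+1)]; last first.
    by rewrite (map_comp (fun k => xi k.+1 w)) valE (iotaDl 1 0) -map_comp.
  (* [ordS] is the successor modulo [n.+1]; it does not wrap around on the first [n] indices. *)
  apply/eq_in_map => i ti; rewrite tnth_mktuple /= modn_small// ltnS.
  have : val i \in iota 0 n by rewrite -valE map_f.
  by rewrite mem_iota.
have max_split w : maxsum [seq xi i w | i <- iota 0 n.+1] =
   (if 0 < S w then xi 0 w else 0) + ((if 0 < S w then tl w else 0) +
   (if 0 < S w then 0 else hd w)).
  have e : xi 0 w :: [seq xi i w | i <- iota 1 n] = rcons [seq xi i w | i <- iota 0 n] (xi n w).
    by rewrite -map_rcons -cats1 -(iotaD 0 n 1) addn1.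
  rewrite [iota 0 n.+1]/= map_cons (maxsum_cons_rcons e).
  have -> : \sum_(z <- xi 0 w :: [seq xi i w | i <- iota 1 n]) z = S w.
    rewrite -[_ :: _]/([seq xi i w | i <- iota 0 n.+1]) big_map.
    by rewrite /S -(big_mkord xpredT (fun i => xi i w)) /index_iota subn0.
  by case: ifP => _; rewrite ?addr0 ?add0r.
under eq_Rintegral do rewrite max_split.
rewrite RintegralD//; last 2 first.
- exact: integrable_if.
- have := integrableD measurableT (integrable_if itl i0) (integrable_if i0 ihd).
  by apply: eq_integrable => // w _; rewrite /= EFinD.
rewrite RintegralD//; [|exact: integrable_if..].
rewrite first_increment -shift -RintegralD//; [|exact: integrable_if..].
congr (_ + _); apply: eq_Rintegral => w _.
by case: ifP => _; rewrite ?addr0 ?add0r.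
Qed.
End spitzer.

(** * Brownian motion *)

Section integral_lemmas.
Context d (T : measurableType d) (R : realType).

(* No measurability is asked of [h], which will be the diameter of the trace. *)
Lemma ae_le_ge0_integral (mu : {measure set T -> \bar R}) (f h : T -> R) :
  measurable_fun setT f -> (forall w, 0 <= f w) -> (forall w, 0 <= h w) ->
  {ae mu, forall w, f w <= h w} ->
  (\int[mu]_w (f w)%:E <= \int[mu]_w (h w)%:E)%E.
Proof.
move=> mf f0 h0 [N [mN N0 fhN]].
have mfE : measurable_fun setT (EFin \o f) by exact/measurable_EFinP.
rewrite (ge0_negligible_integral mN)//; last by move=> w _; rewrite lee_fin.
rewrite integral_mkcond ge0_integralTE; last first.
  by move=> w; rewrite /patch; case: ifP => // _; rewrite lee_fin.
rewrite ge0_integralTE; last by move=> w; rewrite lee_fin.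
apply: ub_ereal_sup => _ [k kle <-].
(* A simple function below [f] cut off to the complement of [N] is below [h] everywhere, on [N]
   because [h] is nonnegative. *)
apply: ereal_sup_ubound; exists k => // w.
apply: le_trans (kle w) _.
rewrite /patch; case: ifPn => [|_]; last by rewrite lee_fin.
move=> /set_mem [_ Nw]; rewrite lee_fin.
by apply: contrapT => fh; apply: Nw; exact: fhN.
Qed.

Context (P : probability T R).

(** Layer-cake formula: for r >= 0 the event that f times the indicator of [F] exceeds r is the
    intersection of f > r with [F], and independence factors its probability. *)
Lemma indep_ge0_integral (f : T -> R) (F : set T) :
  measurable_fun setT f -> (forall w, 0 <= f w) -> measurable F ->
  (forall B, measurable B -> P (f @^-1` B `&` F) = (P (f @^-1` B) * P F)%E) ->
  (\int[P]_(w in F) (f w)%:E = \int[P]_w (f w)%:E * P F)%E.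
Proof.
move=> mf f0 mF ind.
pose g w := f w * \1_F w.
have mg : measurable_fun setT g by exact: measurable_funM.
pose f' : {RV P >-> R} := HB.pack f (isMeasurableFun.Build _ _ _ _ _ mf).
pose g' : {RV P >-> R} := HB.pack g (isMeasurableFun.Build _ _ _ _ _ mg).
have -> : (\int[P]_(w in F) (f w)%:E = 'E_P[g'])%E.
  rewrite unlock integral_mkcond; apply: eq_integral => w _.
  rewrite /patch /= /g indicE; case: ifP => _; rewrite ?mulr1 ?mulr0//.
have -> : (\int[P]_w (f w)%:E = 'E_P[f'])%E by rewrite unlock.
rewrite !ge0_expectation_ccdf//; last first.
  by move=> w; rewrite /= mulr_ge0.
rewrite -ge0_integralZr//.
- apply: eq_integral => r; rewrite inE/= in_itv/= andbT => r0.
  rewrite /ccdf /distribution /pushforward/= -ind//.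
  congr (P _); apply/seteqP; split => w /=; rewrite /g indicE !in_itv/= !andbT.
    have [Fw|] := boolP (w \in F); rewrite ?mulr1 ?mulr0.
      have {}Fw := set_mem Fw.
      by [].
    by move=> _; rewrite ltNge r0.
  by move=> [rf Fw]; rewrite mem_set// mulr1.
- by apply: measurable_funTS; exact: ccdf_measurable.
Qed.

Lemma eq_law_ge0_integral (nu : {measure set (measurableTypeR R) -> \bar R})
    (Z : T -> measurableTypeR R) (D : set (measurableTypeR R))
    (f : measurableTypeR R -> \bar R) :
  measurable_fun setT Z ->
  (forall A, measurable A -> P (Z @^-1` A) = nu A) ->
  measurable D -> measurable_fun D f -> (forall x, (0 <= f x)%E) ->
  (\int[P]_(w in Z @^-1` D) f (Z w) = \int[nu]_(x in D) f x)%E.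
Proof.
move=> mZ lawZ mD mf f0.
pose Z' : {RV P >-> measurableTypeR R} :=
  HB.pack Z (isMeasurableFun.Build _ _ _ _ _ mZ).
rewrite -(ge0_integral_pushforward mZ)//.
by apply: (@eq_measure_integral _ _ _ _ _ (distribution P Z')) => A mA _; exact: lawZ.
Qed.

End integral_lemmas.

(** * The walk sampled on a regular grid *)

Section grid.
Context d (T : measurableType d) (R : realType).
Variables (X : R -> T -> R) (n : nat).
Hypothesis mX : forall t : R, t \in `[0, 1] -> measurable_fun setT (X t).

(* Frozen at time 1, so that every index is legitimate. *)
Definition grid_time i : R := (minn i n)%:R / n%:R.

Definition grid_increment i w := X (grid_time i.+1) w - X (grid_time i) w.

(** Maximum minus minimum of the sampled walk, the minimum being written as minus the maximum of the
    opposite walk so that Spitzer's identity applies to both terms. *)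
Definition grid_range k w :=
  maxsum [seq grid_increment i w | i <- iota 0 k] +
  maxsum [seq - grid_increment i w | i <- iota 0 k].

Lemma grid_time_itv i : grid_time i \in `[0, 1].
Proof.
(* For [n = 0] the grid time is 0, because the inverse of 0 is 0. *)
have [n0|n_gt0] := posnP n.
  by rewrite in_itv/= /grid_time n0 invr0 mulr0 lexx ler01.
rewrite in_itv/= /grid_time divr_ge0//= ler_pdivrMr ?ltr0n// mul1r ler_nat.
exact: geq_minr.
Qed.

Lemma measurable_grid_increment i : measurable_fun setT (grid_increment i).
Proof. by apply: measurable_funB; exact/mX/grid_time_itv. Qed.

Lemma sum_grid_increment k w :
  \sum_(i < k) grid_increment i w = X (grid_time k) w - X (grid_time 0) w.
Proof.
rewrite -(big_mkord xpredT (fun i => grid_increment i w)).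
exact: (telescope_sumr (fun i => X (grid_time i) w) (leq0n k)).
Qed.

Lemma measurable_grid_range k : measurable_fun setT (grid_range k).
Proof.
apply: measurable_funD; first exact: measurable_maxsum measurable_grid_increment.
apply: (@measurable_maxsum _ _ _ _ (fun i w => - grid_increment i w)) => i.
exact/measurable_funN/measurable_grid_increment.
Qed.

(** Both extrema are attained at grid times, and the starting value cancels in the difference. *)
Lemma grid_rangeE w : exists i j, grid_range n w = X (grid_time i) w - X (grid_time j) w.
Proof.
have takeE (f : nat -> R) k : (k <= n)%N ->
    \sum_(x <- take k [seq f i | i <- iota 0 n]) x = \sum_(i < k) f i.
  move=> kn; rewrite -map_take take_iota (minn_idPl kn) big_map.
  by rewrite -(big_mkord xpredT) /index_iota subn0.
have [i i_le iE] := maxsum_take [seq grid_increment i w | i <- iota 0 n].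
have [j j_le jE] := maxsum_take [seq - grid_increment i w | i <- iota 0 n].
rewrite !size_map !size_iota in i_le j_le; exists i, j.
rewrite /grid_range iE jE (takeE (grid_increment ^~ w))// (takeE (fun i => - grid_increment i w))//.
by rewrite sumrN !sum_grid_increment; ring.
Qed.

End grid.

(** * Expected range of the sampled Brownian motion *)

Section brownian_grid.
Context d (T : measurableType d) (R : realType) (P : probability T R).
Variables (X : R -> T -> R) (hX : standard_brownian_motion P X) (n : nat).
Hypothesis n_gt0 : (0 < n)%N.

Local Notation grid_time := (grid_time R n).
Local Notation xi := (grid_increment X n).
Let nR_gt0 : 0 < n%:R :> R. Proof. by rewrite ltr0n. Qed.

Let mX (t : R) : t \in `[0, 1] -> measurable_fun setT (X t).
Proof. by case: hX => mX _ _ _ _; exact: mX. Qed.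

Let grid_time_le i j : (i <= j)%N -> grid_time i <= grid_time j.
Proof.
by move=> ij; rewrite ler_pM2r ?invr_gt0// ler_nat leq_min geq_minr geq_min ij.
Qed.

Let grid_timeE i : (i <= n)%N -> grid_time i = i%:R / n%:R.
Proof. by move=> ik; congr (_%:R / _); exact: (minn_idPl ik). Qed.

Let measurable_X i : measurable_fun setT (X (grid_time i)).
Proof. exact/mX/grid_time_itv. Qed.

Let grid_diff_law i j A : (i < j <= n)%N -> measurable A ->
  P ((fun w => X (grid_time j) w - X (grid_time i) w) @^-1` A) =
  normal_prob 0 (Num.sqrt ((j - i)%:R / n%:R)) A.
Proof.
move=> /andP[ij jn] mA; case: hX => _ _ _ lawX _.
have -> : (j - i)%:R / n%:R = grid_time j - grid_time i.
  by rewrite !grid_timeE ?(leq_trans (ltnW ij))// -mulrBl natrB// ltnW.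
have := grid_time_itv R n i; have := grid_time_itv R n j; rewrite !in_itv/=.
move=> /andP[_ tj] /andP[ti _]; apply: lawX => //.
by rewrite !grid_timeE ?(leq_trans (ltnW ij))// ltr_pM2r ?invr_gt0// ltr_nat.
Qed.

Let sqrt_gt0 j : (0 < j)%N -> 0 < Num.sqrt (j%:R / n%:R) :> R.
Proof. by move=> j0; rewrite sqrtr_gt0 divr_gt0// ltr0n. Qed.

Let integral_norm_diff i j : (i < j <= n)%N ->
  (\int[P]_w (`| X (grid_time j) w - X (grid_time i) w |)%:E =
   (Num.sqrt ((j - i)%:R / n%:R) * Num.sqrt (2 / pi))%:E)%E.
Proof.
move=> ijn; rewrite -integral_normr_normal_prob; last first.
  by apply: sqrt_gt0; rewrite subn_gt0; case/andP: ijn.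
apply: (eq_law_ge0_integral (D := setT) (f := fun x => (`|x|)%:E)
  (Z := fun w => X (grid_time j) w - X (grid_time i) w)) => //.
- exact: measurable_funB.
- by move=> A mA; exact: grid_diff_law.
- by apply/measurable_EFinP; exact: normr_measurable.
Qed.

Let integrable_xi i : P.-integrable setT (EFin \o xi i).
Proof.
have [i_lt_n|n_le_i] := ltnP i n.
  apply/integrableP; split; first by apply/measurable_EFinP; exact: (measurable_grid_increment n mX).
  by rewrite /= integral_norm_diff ?ltnSn//= ltry.
(* From index [n] on the grid is frozen and the increments vanish. *)
rewrite (_ : EFin \o xi i = cst 0%E); first exact: integrable0.
apply/funext => w /=; rewrite /grid_increment.
have -> : grid_time i.+1 = grid_time i; last by rewrite subrr.
by congr (_%:R / _); rewrite !(minn_idPr _)// ltnW.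
Qed.

Let increments_indep k : (k < n)%N ->
  mutually_independent P (fun i : 'I_k.+1 => xi i).
Proof.
move=> kn; case: hX => _ _ indX _ _.
(* The [k.+2] times of indices 0 to [k.+1] delimit the [k.+1] increments. *)
apply: (indX k.+1 (fun i => grid_time i)) => [i|i j ij]; first exact: grid_time_itv.
exact: grid_time_le.
Qed.

Let increments_law i j A : (i < n)%N -> (j < n)%N -> measurable A ->
  P (xi i @^-1` A) = P (xi j @^-1` A).
Proof.
move=> i_lt_n j_lt_n mA.
have lawE k : (k < n)%N -> P (xi k @^-1` A) = normal_prob 0 (Num.sqrt (1%:R / n%:R)) A.
  move=> kn; have k_lt : (k < k.+1 <= n)%N by rewrite ltnSn.
  rewrite -(subSnn k); exact: grid_diff_law k_lt mA.
by rewrite (lawE _ i_lt_n) (lawE _ j_lt_n).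
Qed.

Let measurable_opp_preimage (A : set R) : measurable A -> measurable (-%R @^-1` A).
Proof. by move=> mA; rewrite -[X in measurable X]setTI; exact: oppr_measurable. Qed.

Let opp_increments_indep k : (k < n)%N ->
  mutually_independent P (fun i : 'I_k.+1 => fun w => - xi i w).
Proof.
move=> kn A mA.
by have := increments_indep kn (fun i => measurable_opp_preimage (mA i)).
Qed.

Let opp_increments_law i j A : (i < n)%N -> (j < n)%N -> measurable A ->
  P ((fun w => - xi i w) @^-1` A) = P ((fun w => - xi j w) @^-1` A).
Proof.
by move=> i_lt_n j_lt_n /measurable_opp_preimage; exact: increments_law.
Qed.

Let integrable_oppxi i : P.-integrable setT (EFin \o (fun w => - xi i w)).
Proof.
apply: eq_integrable (integrableZl measurableT (-1) (integrable_xi i)) => // w _.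
by rewrite /= -EFinM mulN1r.
Qed.

Let integrable_max0 (f : T -> R) : P.-integrable setT (EFin \o f) ->
  P.-integrable setT (EFin \o (fun w => Num.max 0 (f w))).
Proof.
move=> fi; apply: (@le_integrable _ _ _ P _ measurableT _ (EFin \o f)) => //.
  apply/measurable_EFinP; apply: measurable_maxr => //.
  by apply/measurable_EFinP; exact: measurable_int fi.
by move=> w _; rewrite /= lee_fin ger0_norm ?le_max ?lexx// ge_max normr_ge0 ler_norm.
Qed.

Lemma integrable_grid_range k : P.-integrable setT (EFin \o grid_range X n k).
Proof.
have := integrableD measurableT (integrable_maxsum (iota 0 k) integrable_xi)
  (integrable_maxsum (iota 0 k) integrable_oppxi).
by apply: eq_integrable => // w _; rewrite /= EFinD.
Qed.

(** Each step adds the Spitzer terms of the walk and of its opposite. As max(0, S) + max(0, -S) =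
    |S|, they amount to E |S| / (k + 1), a Gaussian absolute moment. *)
Lemma expected_grid_range k : (k <= n)%N ->
  \int[P]_w grid_range X n k w =
  \sum_(j < k) Num.sqrt (j.+1%:R / n%:R) * Num.sqrt (2 / pi) / j.+1%:R.
Proof.
have integrable_ms l := integrable_maxsum l integrable_xi.
have integrable_mso l := integrable_maxsum l integrable_oppxi.
rewrite /grid_range RintegralD//.
elim: k => [_|k IH kn].
  by rewrite big_ord0 !Rintegral_cst// !mul0r addr0.
rewrite big_ord_recr/= -(IH (ltnW kn)).
rewrite (spitzer_step integrable_xi (increments_indep kn)); last first.
  by move=> i j A ik jk; apply: increments_law; [exact: leq_trans ik _|exact: leq_trans jk _].
rewrite (spitzer_step integrable_oppxi (opp_increments_indep kn)); last first.
  by move=> i j A ik jk; apply: opp_increments_law; [exact: leq_trans ik _|exact: leq_trans jk _].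
rewrite addrACA [RHS]addrC; congr (_ + _).
rewrite -mulrDl; congr (_ / _).
pose S w := X (grid_time k.+1) w - X (grid_time 0) w.
have integrable_S : P.-integrable setT (EFin \o S).
  apply/integrableP; split; first exact/measurable_EFinP/measurable_funB.
  by rewrite /= integral_norm_diff//= ltry.
have integrable_NS : P.-integrable setT (EFin \o (fun w => - S w)).
  apply: eq_integrable (integrableZl measurableT (-1) integrable_S) => // w _.
  by rewrite /= -EFinM mulN1r.
under eq_Rintegral do rewrite sum_grid_increment.
under [X in _ + X]eq_Rintegral do rewrite sumrN sum_grid_increment.
rewrite -RintegralD//; [|exact: integrable_max0..].
transitivity (\int[P]_w `|S w|).
  apply: eq_Rintegral => w _; rewrite -/(S w).
  case: (ger0P (S w)) => S0.
    by rewrite (max_idPl _) ?addr0 ?oppr_le0.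
  by rewrite (max_idPr _) ?add0r ?oppr_ge0 ?ltW.
by rewrite /Rintegral integral_norm_diff//= subn0.
Qed.

End brownian_grid.

(** Telescoping sum: 1 / sqrt (j + 1) >= 2 (sqrt (j + 2) - sqrt (j + 1)). The induction carries the
    slightly stronger bound with sqrt (n + 1). *)
Lemma sum_inv_sqrt_ge (R : realType) n :
  2 * (Num.sqrt n%:R - 1) <= \sum_(j < n) (Num.sqrt j.+1%:R)^-1 :> R.
Proof.
apply: (@le_trans _ _ (2 * (Num.sqrt n.+1%:R - Num.sqrt 1))).
  by rewrite sqrtr1 ler_pM2l// lerD2r ler_wsqrtr// ler_nat.
elim: n => [|n IH]; first by rewrite big_ord0 subrr mulr0.
rewrite big_ord_recr/=.
apply: le_trans (lerD IH (lexx _)).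
rewrite -lerBlDl -mulrBr [X in 2 * X](_ : _ = Num.sqrt n.+2%:R - Num.sqrt n.+1%:R); last by ring.
have s0 : 0 < Num.sqrt n.+1%:R :> R by rewrite sqrtr_gt0 ltr0n.
rewrite -[leRHS]mul1r ler_pdivlMr//.
have e1 : Num.sqrt n.+1%:R ^+ 2 = n.+1%:R :> R by rewrite sqr_sqrtr.
have e2 : Num.sqrt n.+2%:R ^+ 2 = n.+1%:R + 1 :> R by rewrite sqr_sqrtr// natr1.
(* With a^2 = b^2 + 1, this square gives 2 a b <= 2 b^2 + 1. *)
have := sqr_ge0 (Num.sqrt n.+2%:R - Num.sqrt n.+1%:R : R).
move: (Num.sqrt _) (Num.sqrt _) s0 e1 e2 => a b b0; nra.
Qed.

(** The expectation equals sqrt (2 / (pi n)) times the sum of 1 / sqrt j for j from 1 to n, and 2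
    sqrt (2 / pi) = sqrt (8 / pi). *)
Lemma expected_grid_range_ge d (T : measurableType d) (R : realType)
    (P : probability T R) (X : R -> T -> R) n :
  standard_brownian_motion P X -> (0 < n)%N ->
  Num.sqrt (8 / pi) * (1 - (Num.sqrt n%:R)^-1) <= \int[P]_w grid_range X n n w.
Proof.
move=> hX n0; rewrite (expected_grid_range hX)//.
have sn0 : 0 < Num.sqrt n%:R :> R by rewrite sqrtr_gt0 ltr0n.
have -> : Num.sqrt (8 / pi) = 2 * Num.sqrt (2 / pi) :> R.
  have -> : 8 / pi = 2 ^+ 2 * (2 / pi) :> R by rewrite mulrA; congr (_ / _); ring.
  by rewrite sqrtrM ?exprn_ge0// sqrtr_sqr ger0_norm.
rewrite (eq_bigr (fun j : 'I_n => Num.sqrt (2 / pi) / Num.sqrt n%:R * (Num.sqrt j.+1%:R)^-1)).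
  rewrite -mulr_sumr.
  apply: le_trans (ler_wpM2l _ (sum_inv_sqrt_ge R n)); last first.
    by rewrite divr_ge0// sqrtr_ge0.
  rewrite le_eqVlt; apply/orP; left; apply/eqP; field.
  by rewrite gt_eqF.
move=> j _; rewrite sqrtrM// sqrtrV//.
have sj0 : 0 < Num.sqrt j.+1%:R :> R by rewrite sqrtr_gt0 ltr0n.
rewrite -[X in _ / X = _](@sqr_sqrtr R j.+1%:R)//; field.
by rewrite !gt_eqF.
Qed.

(** * Events determined by a process *)

Section process_sigma_algebra.
Context d (T : measurableType d) (R : realType) (X : R -> T -> R).

(** Named so that [T] can carry the generated sigma-algebra as its measurable structure;
    measurability for it then follows from the general lemmas. *)
Definition process_generators : set (set T) :=
  [set E | exists (t : R) (A : set R),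
     [/\ t \in `[0, 1], measurable A & E = X t @^-1` A] ].

Local Notation TX := (g_sigma_algebraType process_generators).

Lemma measurable_process (t : R) : t \in `[0, 1] ->
  measurable_fun setT (X t : TX -> R).
Proof.
move=> t01 _ B mB; rewrite setTI.
by apply: sub_sigma_algebra; exists t, B.
Qed.

Lemma process_sigma_algebra_preimage (f : TX -> R) (A : set R) :
  measurable_fun setT f -> measurable A -> process_sigma_algebra X (f @^-1` A).
Proof. by move=> mf mA; have := mf measurableT A mA; rewrite setTI. Qed.

End process_sigma_algebra.

(** * Diameter of a bounded planar set *)

Section diameter.
Context {R : realType}.

Lemma euclidean_norm_ge (x : R * R) :
  `|x.1| <= euclidean_norm x /\ `|x.2| <= euclidean_norm x.
Proof.
by split; rewrite -sqrtr_sqr ler_wsqrtr// ?lerDl ?lerDr sqr_ge0.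
Qed.

Lemma euclidean_norm_le (x : R * R) : euclidean_norm x <= `|x.1| + `|x.2|.
Proof.
rewrite -[leRHS]ger0_norm ?addr_ge0// -sqrtr_sqr ler_wsqrtr//.
rewrite sqrrD !real_normK ?num_real// [leRHS]addrAC lerDl.
by rewrite mulrn_wge0// mulr_ge0.
Qed.

Lemma diameter_ge0 (A : set (R * R)) : 0 <= diameter A.
Proof.
(* For an empty or unbounded set of distances, [sup] takes the default value 0. *)
rewrite /diameter; have [[[z Az] ubA]|/sup_out ->//] := pselect (has_sup
  [set euclidean_norm (x - y) | x in A & y in A]).
apply: le_trans (ub_le_sup ubA Az).
by case: Az => x _ [y _ <-]; exact: sqrtr_ge0.
Qed.

(** The coordinate bound [M] keeps the distances bounded, so that [sup] is a genuine supremum. *)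
Lemma diameter_ge (A : set (R * R)) (M : R) (x y : R * R) :
  (forall z, A z -> `|z.1| <= M /\ `|z.2| <= M) -> A x -> A y ->
  euclidean_norm (x - y) <= diameter A.
Proof.
move=> bA Ax Ay; apply: ub_le_sup; last by exists x => //; exists y.
exists (M + M + (M + M)) => _ [u Au] [v Av] <-.
have [u1 u2] := bA _ Au; have [v1 v2] := bA _ Av.
apply: le_trans (euclidean_norm_le _) _.
by apply: lerD; (apply: le_trans (ler_normB _ _) _; exact: lerD).
Qed.

End diameter.

Lemma itv01_continuous_bounded (R : realType) (f : R -> R) :
  {within `[0, 1], continuous f} -> exists M, forall t, t \in `[0, 1] -> `|f t| <= M.
Proof.
move=> cf; have [c _ cmax] := EVT_max ler01 cf.
have [e _ emin] := EVT_min ler01 cf.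
exists (`|f c| + `|f e|) => t t01.
have := cmax _ t01; have := emin _ t01.
rewrite ler_norml => fe fc; apply/andP; split.
  have := lerNnormlW (lexx `|f e|); have := normr_ge0 (f c); lra.
by have := ler_norm (f c); have := normr_ge0 (f e); lra.
Qed.

(** * Lower bound on the expected diameter *)

Section planar_brownian_motion.
Context d (T : measurableType d) (R : realType) (P : probability T R).
Variables (b : R -> T -> R * R) (hb : standard_planar_brownian_motion P b).
Variable n : nat.
Hypothesis n_gt0 : (0 < n)%N.

Let x t w := (b t w).1.
Let y t w := (b t w).2.

Let hx : standard_brownian_motion P x. Proof. by case: hb. Qed.
Let hy : standard_brownian_motion P y. Proof. by case: hb. Qed.

Let Rx := grid_range x n n.
Let Y w := y 1 w - y 0 w.
Let F := Y @^-1` `[2, +oo[.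

Let mx (t : R) : t \in `[0, 1] -> measurable_fun setT (x t).
Proof. by case: hx => mX _ _ _ _; exact: mX. Qed.

Let my (t : R) : t \in `[0, 1] -> measurable_fun setT (y t).
Proof. by case: hy => mY _ _ _ _; exact: mY. Qed.

Let in01_0 : (0 : R) \in `[0, 1]. Proof. by rewrite in_itv/= lexx ler01. Qed.
Let in01_1 : (1 : R) \in `[0, 1]. Proof. by rewrite in_itv/= lexx ler01. Qed.

Let mRx : measurable_fun setT Rx. Proof. exact: measurable_grid_range. Qed.
Let mY : measurable_fun setT Y. Proof. by apply: measurable_funB; exact: my. Qed.

Let Rx_ge0 w : 0 <= Rx w.
Proof. by rewrite addr_ge0// maxsum_ge0. Qed.

Let mF : measurable F.
Proof. by rewrite /F -[X in measurable X]setTI; apply: mY. Qed.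

(** The integrable minorant of the diameter: the event that selects the case depends only on the
    second coordinate, the range only on the first. *)
Let lower w := if 2 <= Y w then `|Y w| else Rx w.

(** In both cases one coordinate is compared at two points of the trace, which almost sure
    continuity makes bounded. *)
Let lower_le_diameter : {ae P, forall w, lower w <= diameter (trace01 b w)}.
Proof.
case: hx => _ _ _ _ cx; case: hy => _ _ _ _ cy.
apply: filterS2 cx cy => w /itv01_continuous_bounded[M hM] /itv01_continuous_bounded[N hN].
have bounded z : trace01 b w z -> `|z.1| <= Num.max M N /\ `|z.2| <= Num.max M N.
  move=> [t t01 <-]; have t01' : t \in `[0, 1] by [].
  by rewrite !le_max (hM _ t01') (hN _ t01') orbT.
have in_trace t : t \in `[0, 1] -> trace01 b w (b t w) by move=> t01; exists t.
rewrite /lower; case: ifP => _.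
  apply: le_trans (diameter_ge bounded (in_trace _ in01_1) (in_trace _ in01_0)).
  exact: (euclidean_norm_ge (b 1 w - b 0 w)).2.
rewrite /Rx; have [i [j ->]] := grid_rangeE x n w.
apply: le_trans (diameter_ge bounded (in_trace _ (grid_time_itv R n i))
  (in_trace _ (grid_time_itv R n j))).
apply: le_trans (euclidean_norm_ge (b _ w - b _ w)).1; exact: ler_norm.
Qed.

Let tail := normal_pdf 0 1 2 : R.

Let integral_Y : (\int[P]_(w in F) (`|Y w|)%:E = tail%:E)%E.
Proof.
have := integral_tail_normal_prob (oner_neq0 R) (ler0n R 2).
rewrite expr1n mul1r => <-.
apply: (eq_law_ge0_integral (Z := Y) (f := fun z => (`|z|)%:E)) => //.
- move=> A mA; case: hy => _ _ _ lawy _.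
  by have := lawy 0 1 (lexx 0) ltr01 (lexx 1) A mA; rewrite subr0 sqrtr1.
- by apply: measurable_funTS; apply/measurable_EFinP; exact: normr_measurable.
Qed.

Let indep_RF B : measurable B ->
  P (Rx @^-1` B `&` ~` F) = (P (Rx @^-1` B) * P (~` F))%E.
Proof.
move=> mB; case: hb => _ _ ind; apply: ind.
  apply: process_sigma_algebra_preimage mB.
  (* The range is measurable for the sigma-algebra of [x] itself, not just for the ambient one. *)
  apply: (@measurable_grid_range _ (g_sigma_algebraType (process_generators x)) R x).
  exact: measurable_process.
rewrite /F preimage_setC; apply: process_sigma_algebra_preimage.
  apply: (@measurable_funB _ (g_sigma_algebraType (process_generators y))).
    exact: measurable_process.
  exact: measurable_process.
exact: measurableC.
Qed.

Let mlower : measurable_fun setT lower.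
Proof.
apply: measurable_fun_ifT => //; first exact: measurable_fun_ler.
by apply: measurableT_comp; first exact: normr_measurable.
Qed.

Let lower_ge0 w : 0 <= lower w.
Proof. by rewrite /lower; case: ifP. Qed.

Let FE w : F w <-> 2 <= Y w.
Proof. by rewrite /F/= in_itv/= andbT. Qed.

(** Markov's inequality on [F], where |Y| is at least 2. *)
Let tail_prob_le : (2%:E * P F <= tail%:E)%E.
Proof.
rewrite -integral_Y -integral_cst//.
have mnY : measurable_fun setT (fun w => `|Y w|).
  by apply: measurableT_comp; first exact: normr_measurable.
apply: ge0_le_integral => //.
- by move=> w _; rewrite lee_fin.
- by apply: measurable_funTS; exact/measurable_EFinP.
- by move=> w /FE Yw; rewrite lee_fin (le_trans Yw)// ler_norm.
Qed.

Lemma expected_diameter_ge (rho := Num.sqrt (8 / pi) * (1 - (Num.sqrt n%:R)^-1) : R) :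
  0 <= rho ->
  ((rho * (1 - tail / 2) + tail)%:E <= 'E_P[fun w => diameter (trace01 b w)])%E.
Proof.
move=> rho0; rewrite unlock.
apply: le_trans (ae_le_ge0_integral mlower lower_ge0 (fun w => diameter_ge0 _) lower_le_diameter).
rewrite -(setUv F) ge0_integral_setU//; last 4 first.
- exact: measurableC.
- by apply: measurable_funTS; exact/measurable_EFinP.
- by move=> w _; rewrite lee_fin.
- by apply/disj_set2P; rewrite setICr.
have -> : (\int[P]_(w in F) (lower w)%:E = tail%:E)%E.
  rewrite -integral_Y; apply: eq_integral => w /set_mem/FE Yw.
  by rewrite /lower Yw.
have -> : (\int[P]_(w in ~` F) (lower w)%:E = \int[P]_(w in ~` F) (Rx w)%:E)%E.
  apply: eq_integral => w /set_mem/= NFw; rewrite /lower.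
  by case: ifPn => // /FE.
rewrite (indep_ge0_integral mRx Rx_ge0 (measurableC mF) indep_RF).
have iRx := integrable_grid_range hx n_gt0 n.
have := expected_grid_range_ge hx n_gt0.
rewrite -/rho /Rintegral -lee_fin fineK; last exact: integrable_fin_num iRx.
rewrite probability_setC// => rho_le.
have /fineK PF : P F \is a fin_num by rewrite fin_num_measure.
move: tail_prob_le; rewrite -PF -EFinM lee_fin => q_le.
have q1 : fine (P F) <= 1 by rewrite -lee_fin PF probability_le1.
rewrite -EFinB; move: (fine _) q_le q1 => q q_le q1.
(* The expected range is lowered to [rho], as 1 - q >= 0; then [q] is raised to [tail / 2], as rho
   >= 0. *)
apply: le_trans (_ : (tail%:E + rho%:E * (1 - q)%:E <= _)%E); last first.
  by rewrite leeD2l// lee_wpmul2r// lee_fin subr_ge0.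
rewrite -EFinM -EFinD lee_fin addrC lerD2l ler_wpM2l// lerD2l lerN2.
by rewrite ler_pdivlMr// mulrC.
Qed.

End planar_brownian_motion.

(** The density at 2 is exp(-2) / sqrt (2 pi); from exp(-1) >= 1/3 and sqrt (2 pi) <= 2.6 it is at
    least 1 / 23.4 > 0.04. *)
Lemma normal_tail_bounds (R : realType) : 4 / 100 <= (normal_pdf 0 1 2 : R) <= 1.
Proof.
have p0 := @pi_gt0 R; have /andP[_ pih] := pihalf_bounds R.
rewrite normal_pdfE ?oner_neq0// /normal_peak /normal_fun expr1n mul1r subr0.
have -> : - 2 ^+ 2 / (1 *+ 2) = - (1 + 1) :> R by lra.
have p1 : 1 <= Num.sqrt (pi *+ 2) :> R.
  rewrite -sqrtr1 ler_wsqrtr// mulr2n; have := @pi_ge2 R; lra.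
apply/andP; split; last first.
  rewrite ler_pdivrMl ?(lt_le_trans ltr01)// mulr1; apply: le_trans p1.
  by rewrite -expR0 ler_expR oppr_le0 addr_ge0.
rewrite opprD expRD -[pi *+ 2]mulr_natr.
have e1 : 1 / 3 <= expR (- 1) :> R.
  have := expN_taylorP 4 (@ler01 R).
  by rewrite /expN_taylor !big_ord_recr big_ord0 /=; lra.
have s0 : 0 < Num.sqrt (pi * 2) :> R by rewrite sqrtr_gt0 mulr_gt0.
have s1 : Num.sqrt (pi * 2) <= 26 / 10 :> R.
  rewrite -[leRHS]ger0_norm; last by lra.
  rewrite -sqrtr_sqr ler_wsqrtr//; lra.
rewrite ler_pdivlMl//.
have e2 : (1 / 3) ^+ 2 <= expR (- 1) * expR (- 1) :> R.
  by rewrite -expr2 lerXn2r ?nnegrE ?expR_ge0//; lra.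
by lra.
Qed.

Theorem proposition4 (R : realType) (d : measure_display)
    (T : measurableType d) (P : probability T R) (b : R -> T -> R * R)
    (hb : standard_planar_brownian_motion P b) :
  (((Num.sqrt (8 / pi) + g (1492 / 1000) (337 / 1000) : R)%:E
     <= 'E_P[fun w => diameter (trace01 b w)])%E)
  /\ `| Num.sqrt (8 / pi) + g (1492 / 1000) (337 / 1000) - (1 + 6 / 10 + 14 / 10 ^+ 4) : R |
       < 5 / 10 ^+ 5.
Proof.
split; last exact: sqrt_8pi_g_approx.
(* A million sampling times bring 1 / sqrt n down to 1/1000, the loss allowed in the final
   arithmetic. *)
have [n n_large] : exists n : nat, 1000 <= Num.sqrt n%:R :> R.
  have sqrt_sqr m : Num.sqrt (m ^ 2)%N%:R = m%:R :> R.
    by rewrite natrX sqrtr_sqr ger0_norm.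
  exists (1000 ^ 2)%N; rewrite sqrt_sqr; exact: lexx.
have n_gt0 : (0 < n)%N.
  by rewrite lt0n; apply/eqP => n0; move: n_large; rewrite n0 sqrtr0; lra.
have inv_bounds : 0 <= (Num.sqrt n%:R : R)^-1 <= 1000^-1.
  rewrite invr_ge0 sqrtr_ge0 lef_pV2 ?posrE; [exact: n_large|lra|lra].
have [rho_ge0 le_rho] := range_tail_arith (sqrt_8pi_bounds R) (g_bounds R)
  (normal_tail_bounds R) inv_bounds.
exact: le_trans (expected_diameter_ge hb n_gt0 rho_ge0).
Qed.
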